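(* (Yanking.) Let $\mathbf C$ be a cancellative atomic Markov category with conditionals. For every object $W$, the symmetry $\mathrm{swap}_{W,W}:W\otimes W\to W\otimes W$ is traceable, and $\mathbf{tr}^W(\mathrm{swap}_{W,W})=\mathrm{id}_W$.
   Context: A Markov category is a symmetric monoidal category $(\mathbf C,\otimes,I)$ in which every object $X$ carries a commutative comonoid $\Delta_X:X\to X\otimes X$, $\mathrm{del}_X:X\to I$, compatible with $\otimes$, and every $f:X\to Y$ satisfies $\mathrm{del}_Y\circ f=\mathrm{del}_X$. Naturality of $\Delta$ is not assumed. Coherence isomorphisms are suppressed. $\mathbf C$ has conditionals if for every $f:A\to X\otimes Y$ there is $f|_X:X\otimes A\to Y$ with $f=(\mathrm{id}_X\otimes f|_X)\circ(\Delta_X\otimes\mathrm{id}_A)\circ\big(((\mathrm{id}_X\otimes\mathrm{del}_Y)\circ f)\otimes\mathrm{id}_A\big)\circ\Delta_A$. For $p:A\to X$ and $f_1,f_2:W\otimes X\to Y$, write $f_1=_pf_2$ if $(f_1\otimes\mathrm{id}_X)\circ(\mathrm{id}_W\otimes(\Delta_X\circ p))=(f_2\otimes\mathrm{id}_X)\circ(\mathrm{id}_W\otimes(\Delta_X\circ p))$. For $p:A\to X$, $q:B\to X$ write $p\ll q$ if for all $W,Y$ and $f_1,f_2:W\otimes X\to Y$, $f_1=_qf_2$ implies $f_1=_pf_2$. $p:A\to X$ is atomic if $\Delta_X\circ p\ll p\otimes p$; $\mathbf C$ is atomic if all its morphisms are. An object $W$ is cancellable if $\mathrm{del}_W\otimes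 f_1=\mathrm{del}_W\otimes f_2$ implies $f_1=f_2$ for all parallel $f_1,f_2$; $\mathbf C$ is cancellative if all objects are cancellable. A morphism $f:X\otimes W'\to Y\otimes W$ is non-signalling (from $W'$ to $W$) if there is $f_s:X\to W$ with $(\mathrm{del}_Y\otimes\mathrm{id}_W)\circ f=f_s\otimes\mathrm{del}_{W'}$. A disintegration of $f$ is a pair $f_s:X\to W$, $f_p:X\otimes W\otimes W'\to Y$ with $f=(f_p\otimes\mathrm{id}_W)\circ(\mathrm{id}_{X\otimes W}\otimes\mathrm{swap}_{W,W'})\circ(s\otimes\mathrm{id}_{W'})$, where $s=(\mathrm{id}_X\otimes(\Delta_W\circ f_s))\circ\Delta_X:X\to X\otimes W\otimes W$. In a Markov category with conditionals, $f$ is non-signalling iff it has a disintegration. $f:X\otimes W\to Y\otimes W$ is called traceable (with respect to $W$) if it is non-signalling from the input $W$ to the output $W$; its causal trace is $\mathbf{tr}^W(f)=f_p\circ s:X\to Y$ for any disintegration (with $W'=W$); under the stated assumptions on $\mathbf C$ this does not depend on the choice of disintegration. *)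

(* Defs.v *)
Set Implicit Arguments.
Unset Strict Implicit.
Unset Printing Implicit Defensive.

Declare Scope cat_scope.
Delimit Scope cat_scope with cat.
Local Open Scope cat_scope.

Record category : Type := Category {
  ob :> Type;
  hom : ob -> ob -> Type;
  idm : forall X, hom X X;
  comp : forall X Y Z, hom Y Z -> hom X Y -> hom X Z;
  comp_idl : forall X Y (f : hom X Y), comp (idm Y) f = f;
  comp_idr : forall X Y (f : hom X Y), comp f (idm X) = f;
  comp_assoc : forall X Y Z T (h : hom Z T) (g : hom Y Z) (f : hom X Y),
    comp h (comp g f) = comp (comp h g) f
}.

Arguments hom {c} X Y.
Arguments idm {c} X.
Arguments comp {c X Y Z} g f.

Notation "g ∘ f" := (comp g f) (at level 40, left associativity) : cat_scope.

(* The monoidal structure is not assumed strict, so the coherence isomorphisms,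
   which are left out on paper, occur explicitly in everything below. *)
Record symMonCat : Type := SymMonCat {
  smc_cat :> category;
  unit_ob : smc_cat;
  tens : smc_cat -> smc_cat -> smc_cat;
  tensm : forall X Y X' Y' : smc_cat,
    hom X Y -> hom X' Y' -> hom (tens X X') (tens Y Y');
  tensm_id : forall X Y : smc_cat, tensm (idm X) (idm Y) = idm (tens X Y);
  tensm_comp : forall (X Y Z X' Y' Z' : smc_cat)
      (g : hom Y Z) (f : hom X Y) (g' : hom Y' Z') (f' : hom X' Y'),
    tensm (g ∘ f) (g' ∘ f') = tensm g g' ∘ tensm f f';

  assoc : forall X Y Z : smc_cat,
    hom (tens (tens X Y) Z) (tens X (tens Y Z));
  associ : forall X Y Z : smc_cat,
    hom (tens X (tens Y Z)) (tens (tens X Y) Z);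
  assocK : forall X Y Z, associ X Y Z ∘ assoc X Y Z = idm _;
  associK : forall X Y Z, assoc X Y Z ∘ associ X Y Z = idm _;
  assoc_nat : forall (X Y Z X' Y' Z' : smc_cat)
      (f : hom X X') (g : hom Y Y') (h : hom Z Z'),
    assoc X' Y' Z' ∘ tensm (tensm f g) h = tensm f (tensm g h) ∘ assoc X Y Z;

  lunit : forall X : smc_cat, hom (tens unit_ob X) X;
  luniti : forall X : smc_cat, hom X (tens unit_ob X);
  lunitK : forall X, luniti X ∘ lunit X = idm _;
  lunitiK : forall X, lunit X ∘ luniti X = idm _;
  lunit_nat : forall (X Y : smc_cat) (f : hom X Y),
    lunit Y ∘ tensm (idm unit_ob) f = f ∘ lunit X;

  runit : forall X : smc_cat, hom (tens X unit_ob) X;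
  runiti : forall X : smc_cat, hom X (tens X unit_ob);
  runitK : forall X, runiti X ∘ runit X = idm _;
  runitiK : forall X, runit X ∘ runiti X = idm _;
  runit_nat : forall (X Y : smc_cat) (f : hom X Y),
    runit Y ∘ tensm f (idm unit_ob) = f ∘ runit X;

  pentagon : forall X Y Z T : smc_cat,
    assoc X Y (tens Z T) ∘ assoc (tens X Y) Z T =
    tensm (idm X) (assoc Y Z T) ∘ assoc X (tens Y Z) T
      ∘ tensm (assoc X Y Z) (idm T);
  triangle : forall X Y : smc_cat,
    tensm (idm X) (lunit Y) ∘ assoc X unit_ob Y = tensm (runit X) (idm Y);

  swap : forall X Y : smc_cat, hom (tens X Y) (tens Y X);
  swapK : forall X Y, swap Y X ∘ swap X Y = idm _;
  swap_nat : forall (X Y X' Y' : smc_cat) (f : hom X Y) (g : hom X' Y'),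
    swap Y Y' ∘ tensm f g = tensm g f ∘ swap X X';
  hexagon : forall X Y Z : smc_cat,
    assoc Y Z X ∘ swap X (tens Y Z) ∘ assoc X Y Z =
    tensm (idm Y) (swap X Z) ∘ assoc Y X Z ∘ tensm (swap X Y) (idm Z)
}.

Arguments unit_ob {s}.
Arguments tens {s} X Y.
Arguments tensm {s X Y X' Y'} f g.
Arguments assoc {s} X Y Z.
Arguments associ {s} X Y Z.
Arguments lunit {s} X.
Arguments luniti {s} X.
Arguments runit {s} X.
Arguments runiti {s} X.
Arguments swap {s} X Y.

Notation "X ⊗ Y" := (tens X Y) (at level 36, left associativity) : cat_scope.
Notation "f ⊗₁ g" := (tensm f g) (at level 36, left associativity) : cat_scope.

(* (X ⊗ Y) ⊗ (Z ⊗ T) -> (X ⊗ Z) ⊗ (Y ⊗ T), exchanging the two middle factors *)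
Definition mid_swap (C : symMonCat) (X Y Z T : C) :
    hom ((X ⊗ Y) ⊗ (Z ⊗ T)) ((X ⊗ Z) ⊗ (Y ⊗ T)) :=
  associ X Z (Y ⊗ T)
    ∘ (idm X ⊗₁ (assoc Z Y T ∘ (swap Y Z ⊗₁ idm T) ∘ associ Y Z T))
    ∘ assoc X Y (Z ⊗ T).

Record markovCat : Type := MarkovCat {
  markov_smc :> symMonCat;
  copy : forall X : markov_smc, hom X (X ⊗ X);
  del : forall X : markov_smc, hom X unit_ob;
  copy_assoc : forall X,
    assoc X X X ∘ (copy X ⊗₁ idm X) ∘ copy X = (idm X ⊗₁ copy X) ∘ copy X;
  copy_dell : forall X, lunit X ∘ (del X ⊗₁ idm X) ∘ copy X = idm X;
  copy_delr : forall X, runit X ∘ (idm X ⊗₁ del X) ∘ copy X = idm X;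
  copy_comm : forall X, swap X X ∘ copy X = copy X;
  copy_tens : forall X Y, copy (X ⊗ Y) = mid_swap X X Y Y ∘ (copy X ⊗₁ copy Y);
  del_tens : forall X Y, del (X ⊗ Y) = lunit unit_ob ∘ (del X ⊗₁ del Y);
  (* the unit part of compatibility with the monoidal structure; the other
     axioms imply it *)
  copy_unit : copy unit_ob = luniti unit_ob;
  del_unit : del unit_ob = idm unit_ob;
  del_nat : forall (X Y : markov_smc) (f : hom X Y), del Y ∘ f = del X
}.

Arguments copy {m} X.
Arguments del {m} X.

Definition is_conditional (C : markovCat) (A X Y : C)
    (f : hom A (X ⊗ Y)) (g : hom (X ⊗ A) Y) : Prop :=
  f = (idm X ⊗₁ g) ∘ assoc X X A ∘ (copy X ⊗₁ idm A)
        ∘ ((runit X ∘ (idm X ⊗₁ del Y) ∘ f) ⊗₁ idm A) ∘ copy A.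

Definition has_conditionals (C : markovCat) : Prop :=
  forall (A X Y : C) (f : hom A (X ⊗ Y)),
    exists g : hom (X ⊗ A) Y, is_conditional f g.

(* f1 =_p f2 *)
Definition as_eq (C : markovCat) (A X W Y : C) (p : hom A X)
    (f1 f2 : hom (W ⊗ X) Y) : Prop :=
  (f1 ⊗₁ idm X) ∘ associ W X X ∘ (idm W ⊗₁ (copy X ∘ p)) =
  (f2 ⊗₁ idm X) ∘ associ W X X ∘ (idm W ⊗₁ (copy X ∘ p)).

Definition abs_cont (C : markovCat) (A B X : C)
    (p : hom A X) (q : hom B X) : Prop :=
  forall (W Y : C) (f1 f2 : hom (W ⊗ X) Y), as_eq q f1 f2 -> as_eq p f1 f2.

Notation "p ≪ q" := (abs_cont p q) (at level 70, no associativity) : cat_scope.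

Definition atomic_hom (C : markovCat) (A X : C) (p : hom A X) : Prop :=
  (copy X ∘ p) ≪ (p ⊗₁ p).

Definition atomic (C : markovCat) : Prop :=
  forall (A X : C) (p : hom A X), atomic_hom p.

Definition cancellable (C : markovCat) (W : C) : Prop :=
  forall (X Y : C) (f1 f2 : hom X Y), del W ⊗₁ f1 = del W ⊗₁ f2 -> f1 = f2.

Definition cancellative (C : markovCat) : Prop :=
  forall W : C, cancellable W.

Definition non_signalling (C : markovCat) (X Y W W' : C)
    (f : hom (X ⊗ W') (Y ⊗ W)) : Prop :=
  exists fs : hom X W,
    lunit W ∘ (del Y ⊗₁ idm W) ∘ f = runit W ∘ (fs ⊗₁ del W').

(* the map s built from the first component f_s of a disintegration *)
Definition disint_state (C : markovCat) (X W : C) (fs : hom X W) :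
    hom X (X ⊗ W ⊗ W) :=
  associ X W W ∘ (idm X ⊗₁ (copy W ∘ fs)) ∘ copy X.

Definition is_disintegration (C : markovCat) (X Y W W' : C)
    (f : hom (X ⊗ W') (Y ⊗ W))
    (fs : hom X W) (fp : hom (X ⊗ W ⊗ W') Y) : Prop :=
  f = (fp ⊗₁ idm W) ∘ associ (X ⊗ W) W' W ∘ (idm (X ⊗ W) ⊗₁ swap W W')
        ∘ assoc (X ⊗ W) W W' ∘ (disint_state fs ⊗₁ idm W').

Definition traceable (C : markovCat) (X Y W : C)
    (f : hom (X ⊗ W) (Y ⊗ W)) : Prop :=
  non_signalling f.

(* tr^W(f) = t, with W read off from the type of f: f is traceable, has a
   disintegration, and every disintegration of f yields t.  Independence of the
   choice is thus part of the predicate, and t is unique when it exists. *)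
Definition is_causal_trace (C : markovCat) (X Y W : C)
    (f : hom (X ⊗ W) (Y ⊗ W)) (t : hom X Y) : Prop :=
  traceable f /\
  (exists (fs : hom X W) (fp : hom (X ⊗ W ⊗ W) Y), is_disintegration f fs fp) /\
  (forall (fs : hom X W) (fp : hom (X ⊗ W ⊗ W) Y),
     is_disintegration f fs fp -> fp ∘ disint_state fs = t).

(* Main.v *)
(** Write a disintegration of the swap as a pair [fs], [fp].  Its marginal on
    the traced wire is [fs] applied to the first input, while the marginal of
    the swap there is the first input itself; cancellativity gives [fs = id].
    The state then consists of three copies of the input, and the other marginal
    says that [fp] fed with [(x, x, w)] returns [w].  Composing [fp] with the
    state is the case [w = x] of this. *)

From Corelib Require Import ssreflect.
Require Import Defs.

Set Implicit Arguments.
Unset Strict Implicit.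
Unset Printing Implicit Defensive.

Local Open Scope cat_scope.

(** Composites nest to the left, so [g ∘ f] is not a subterm of [h ∘ g ∘ f]; this form lets its
    value be rewritten there. *)
Lemma comp_rew (C : category) (X Y Z T : C) (h : hom Z T) (g : hom Y Z)
    (f : hom X Y) (k : hom X Z) :
  g ∘ f = k -> h ∘ g ∘ f = h ∘ k.
Proof. by move=> <-; rewrite comp_assoc. Qed.

Lemma comp_epi (C : category) (X Y Z : C) (i : hom X Y) (j : hom Y X)
    (f g : hom Y Z) :
  i ∘ j = idm Y -> f ∘ i = g ∘ i -> f = g.
Proof.
by move=> ij E; rewrite -[f]comp_idr -[g]comp_idr -ij !comp_assoc E.
Qed.

Lemma comp_mono (C : category) (X Y Z : C) (i : hom Y Z) (j : hom Z Y)
    (f g : hom X Y) :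
  j ∘ i = idm Y -> i ∘ f = i ∘ g -> f = g.
Proof.
by move=> ji E; rewrite -[f]comp_idl -[g]comp_idl -ji -!comp_assoc E.
Qed.

(** * Coherence of the unitors with tensor and symmetry *)

Section Monoidal.
Variable C : symMonCat.
Implicit Types X Y Z T : C.

Lemma tensm_compl X Y Z T (g : hom Y Z) (f : hom X Y) :
  (g ∘ f) ⊗₁ idm T = (g ⊗₁ idm T) ∘ (f ⊗₁ idm T).
Proof. by rewrite -tensm_comp comp_idl. Qed.

Lemma tensm_compr X Y Z T (g : hom Y Z) (f : hom X Y) :
  idm T ⊗₁ (g ∘ f) = (idm T ⊗₁ g) ∘ (idm T ⊗₁ f).
Proof. by rewrite -tensm_comp comp_idl. Qed.

(** By naturality of [runit], tensoring with the unit is isomorphic to the identity functor, hence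
    faithful. *)
Lemma tensm_unitr_inj X Y (f g : hom X Y) :
  f ⊗₁ idm unit_ob = g ⊗₁ idm unit_ob -> f = g.
Proof.
move=> E; apply: (comp_epi (runitiK X)).
by rewrite -!runit_nat E.
Qed.

Lemma tensm_unitl_inj X Y (f g : hom X Y) :
  idm unit_ob ⊗₁ f = idm unit_ob ⊗₁ g -> f = g.
Proof.
move=> E; apply: (comp_epi (lunitiK X)).
by rewrite -!lunit_nat E.
Qed.

(** Kelly's argument: by faithfulness it suffices to tensor with the unit, where the pentagon and
    the triangle give the equation. *)
Lemma runit_tens X Y : (idm X ⊗₁ runit Y) ∘ assoc X Y unit_ob = runit (X ⊗ Y).
Proof.
apply: tensm_unitr_inj; apply: (comp_mono (assocK X Y unit_ob)).
rewrite tensm_compl comp_assoc assoc_nat -triangle tensm_compr.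
rewrite -!comp_assoc (comp_assoc _ (assoc X (Y ⊗ unit_ob) unit_ob)) -pentagon.
rewrite -triangle !comp_assoc -assoc_nat.
by rewrite tensm_id.
Qed.

Lemma lunit_tens X Y : lunit (X ⊗ Y) ∘ assoc unit_ob X Y = lunit X ⊗₁ idm Y.
Proof.
apply: tensm_unitl_inj.
apply: (comp_epi (associK unit_ob (unit_ob ⊗ X) Y)).
apply: (@comp_epi _ _ _ _ (assoc unit_ob unit_ob X ⊗₁ idm Y)
         (associ unit_ob unit_ob X ⊗₁ idm Y)).
  by rewrite -tensm_compl associK tensm_id.
rewrite -assoc_nat -[RHS]comp_assoc -tensm_compl triangle assoc_nat tensm_id.
rewrite tensm_compr -!comp_assoc.
rewrite (comp_assoc _ (assoc unit_ob (unit_ob ⊗ X) Y)) -pentagon !comp_assoc.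
by rewrite triangle.
Qed.

(** After tensoring with the unit, this follows from the hexagon at [X] and two units, reduced by
    the triangle. *)
Lemma lunit_swap X : lunit X ∘ swap X unit_ob = runit X.
Proof.
apply: tensm_unitl_inj.
apply: (comp_epi (associK unit_ob X unit_ob)).
apply: (@comp_epi _ _ _ _ (swap X unit_ob ⊗₁ idm unit_ob)
         (swap unit_ob X ⊗₁ idm unit_ob)).
  by rewrite -tensm_compl swapK tensm_id.
rewrite runit_tens runit_nat -runit_tens.
rewrite tensm_compr -!comp_assoc (comp_assoc _ (assoc _ _ _)) -hexagon.
by rewrite !comp_assoc triangle swap_nat.
Qed.

Lemma runit_swap X : runit X ∘ swap unit_ob X = lunit X.
Proof. by rewrite -lunit_swap -comp_assoc swapK comp_idr. Qed.

End Monoidal.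

(** * Marginals, disintegrations and the swap *)

Section Markov.
Variable C : markovCat.
Implicit Types X Y Z W : C.

(** Composing with these takes marginals. As [copy] need not be natural, the marginals need not
    determine a map into a tensor. *)
Definition fst_m X Y : hom (X ⊗ Y) X := runit X ∘ (idm X ⊗₁ del Y).
Definition snd_m X Y : hom (X ⊗ Y) Y := lunit Y ∘ (del X ⊗₁ idm Y).

Lemma fst_nat X Y X' Y' (f : hom X X') (g : hom Y Y') :
  fst_m X' Y' ∘ (f ⊗₁ g) = f ∘ fst_m X Y.
Proof.
rewrite /fst_m -comp_assoc -tensm_comp del_nat comp_idl comp_assoc -runit_nat.
by rewrite -comp_assoc -tensm_comp comp_idl comp_idr.
Qed.

Lemma snd_nat X Y X' Y' (f : hom X X') (g : hom Y Y') :
  snd_m X' Y' ∘ (f ⊗₁ g) = g ∘ snd_m X Y.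
Proof.
rewrite /snd_m -comp_assoc -tensm_comp del_nat comp_idl comp_assoc -lunit_nat.
by rewrite -comp_assoc -tensm_comp comp_idl comp_idr.
Qed.

Lemma fst_swap X Y : fst_m Y X ∘ swap X Y = snd_m X Y.
Proof. by rewrite /fst_m -comp_assoc -swap_nat comp_assoc runit_swap. Qed.

Lemma snd_swap X Y : snd_m Y X ∘ swap X Y = fst_m X Y.
Proof. by rewrite /snd_m -comp_assoc -swap_nat comp_assoc lunit_swap. Qed.

Lemma fst_assoc X Y Z : (idm X ⊗₁ fst_m Y Z) ∘ assoc X Y Z = fst_m (X ⊗ Y) Z.
Proof.
rewrite /fst_m -runit_tens tensm_compr -!comp_assoc -assoc_nat.
by rewrite tensm_id.
Qed.

Lemma fst_associ X Y Z : fst_m (X ⊗ Y) Z ∘ associ X Y Z = idm X ⊗₁ fst_m Y Z.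
Proof. by rewrite -fst_assoc -comp_assoc associK comp_idr. Qed.

Lemma snd_assoc X Y Z : snd_m X (Y ⊗ Z) ∘ assoc X Y Z = snd_m X Y ⊗₁ idm Z.
Proof.
by rewrite /snd_m tensm_compl -lunit_tens -!comp_assoc assoc_nat tensm_id.
Qed.

Lemma snd_associ X Y Z : (snd_m X Y ⊗₁ idm Z) ∘ associ X Y Z = snd_m X (Y ⊗ Z).
Proof. by rewrite -snd_assoc -comp_assoc associK comp_idr. Qed.

(** The triangle axiom, once the middle factor has been discarded. *)
Lemma mid_assoc X Y Z : (idm X ⊗₁ snd_m Y Z) ∘ assoc X Y Z = fst_m X Y ⊗₁ idm Z.
Proof.
rewrite /fst_m /snd_m tensm_compr tensm_compl -triangle -!comp_assoc.
by rewrite -assoc_nat.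
Qed.

Lemma fst_copy X : fst_m X X ∘ copy X = idm X.
Proof. exact: copy_delr. Qed.

Lemma snd_copy X : snd_m X X ∘ copy X = idm X.
Proof. exact: copy_dell. Qed.

Lemma snd_snd_associ X Y Z :
  snd_m (X ⊗ Y) Z ∘ associ X Y Z = snd_m Y Z ∘ snd_m X (Y ⊗ Z).
Proof.
by rewrite -snd_associ comp_assoc snd_nat comp_idl.
Qed.

Lemma fst_snd_assoc X Y Z :
  fst_m Y Z ∘ snd_m X (Y ⊗ Z) ∘ assoc X Y Z = snd_m X Y ∘ fst_m (X ⊗ Y) Z.
Proof. by rewrite -comp_assoc snd_assoc fst_nat. Qed.

Lemma snd_disint_state X W (fs : hom X W) : snd_m _ _ ∘ disint_state fs = fs.
Proof.
rewrite /disint_state !comp_assoc snd_snd_associ (comp_rew _ (snd_nat _ _)).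
rewrite !(comp_assoc (snd_m W W)) snd_copy comp_idl -comp_assoc.
by rewrite snd_copy comp_idr.
Qed.

(** Coassociativity: the state consists of three copies of the input, bracketed to the left. *)
Lemma disint_state_id W :
  disint_state (idm W) = (copy W ⊗₁ idm W) ∘ copy W.
Proof.
rewrite /disint_state comp_idr -comp_assoc -copy_assoc !comp_assoc.
by rewrite assocK comp_idl.
Qed.

(** Discarding [Y] absorbs [fp]; what is left is the second copy of the output of [fs]. *)
Lemma disintegration_snd X Y W W' (f : hom (X ⊗ W') (Y ⊗ W)) fs fp :
  is_disintegration f fs fp -> snd_m Y W ∘ f = fs ∘ fst_m X W'.
Proof.
move=> ->; rewrite !comp_assoc snd_nat comp_idl snd_snd_associ.
rewrite (comp_rew _ (snd_nat _ _)) comp_assoc snd_swap fst_snd_assoc.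
rewrite (comp_rew _ (fst_nat _ _)) comp_assoc snd_disint_state.
by rewrite /fst_m !comp_assoc.
Qed.

(** The copy of [W] sent to the output is discarded, so [fp] sees the other two wires of the state
    and the input [W']. *)
Lemma disintegration_fst X Y W W' (f : hom (X ⊗ W') (Y ⊗ W)) fs fp :
  is_disintegration f fs fp ->
  fst_m Y W ∘ f = fp ∘ ((fst_m (X ⊗ W) W ∘ disint_state fs) ⊗₁ idm W').
Proof.
rewrite /is_disintegration; move: (disint_state fs) => s ->.
rewrite !comp_assoc fst_nat (comp_rew _ (fst_associ _ _ _)).
rewrite -(comp_assoc fp) -tensm_compr fst_swap.
by rewrite (comp_rew _ (mid_assoc _ _ _)) -comp_assoc -tensm_compl.
Qed.

(** Up to the symmetry and the left unitor, precomposing with [fst_m] is tensoring with [del W]. *)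
Lemma fst_cancel X Y W (f g : hom X Y) :
  cancellable W -> f ∘ fst_m X W = g ∘ fst_m X W -> f = g.
Proof.
move=> cW E; apply: cW; apply: (comp_mono (lunitK Y)).
have lunit_del (h : hom X Y) : lunit Y ∘ (del W ⊗₁ h) = h ∘ fst_m X W ∘ swap W X.
  rewrite -comp_assoc fst_swap /snd_m comp_assoc -lunit_nat.
  by rewrite -comp_assoc -tensm_comp comp_idl comp_idr.
by rewrite !lunit_del E.
Qed.

(** The output [W] receives a copy of the first input, and [fp] returns the second input, discarding
    its other two wires. *)
Lemma swap_disintegration W :
  is_disintegration (swap W W) (idm W) (snd_m (W ⊗ W) W).
Proof.
rewrite /is_disintegration snd_associ snd_nat.
rewrite (comp_rew _ (snd_assoc _ _ _)) -comp_assoc -tensm_compl.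
by rewrite snd_disint_state tensm_id comp_idr.
Qed.

Lemma swap_disintegration_state W (fs : hom W W) fp :
  cancellable W -> is_disintegration (swap W W) fs fp -> fs = idm W.
Proof.
move=> cW /disintegration_snd E; apply: (fst_cancel cW).
by rewrite -E snd_swap comp_idl.
Qed.

Lemma swap_disintegration_trace W (fs : hom W W) fp :
  cancellable W -> is_disintegration (swap W W) fs fp ->
  fp ∘ disint_state fs = idm W.
Proof.
move=> cW D; have Efs := swap_disintegration_state cW D; subst fs.
(* With [fs] the identity, the first marginal becomes [snd_m W W = fp ∘ (copy W ⊗₁ idm W)];
   precomposing with [copy W] then evaluates the trace. *)
have := disintegration_fst D; rewrite fst_swap disint_state_id.
rewrite comp_assoc fst_nat -(comp_assoc (copy W)) fst_copy comp_idr => E.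
by rewrite comp_assoc -E snd_copy.
Qed.

End Markov.

Theorem proposition25 (C : markovCat) (hcond : has_conditionals C)
    (hatom : atomic C) (hcanc : cancellative C) (W : C) :
  traceable (swap W W) /\ is_causal_trace (swap W W) (idm W).
Proof.
have T : traceable (swap W W).
  (* The second output of the swap is its first input, hence this witness. *)
  by exists (idm W); rewrite -/(snd_m W W) snd_swap.
split=> //; split=> //; split.
  by exists (idm W), (snd_m (W ⊗ W) W); apply: swap_disintegration.
by move=> fs fp; apply: swap_disintegration_trace.
Qed.
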